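(* For any given $x^0\in\mathbb{R}^n$ and $\alpha_0>0$, the stepsizes $\{\alpha_k\}$ generated by the general AdaBB algorithm with the choice of $\theta_0$ given in the context satisfy $\alpha_i\ge\frac{1}{\sqrt2L}$ for all $i\ge1$, and hence $\sum_{i=1}^k\alpha_i\ge\frac{k}{\sqrt2L}$ for any $k\ge1$.
   Context: $\|\cdot\|$ is the Euclidean norm and $B(x,r)$ the closed ball with center $x$ and radius $r$. $f:\mathbb{R}^n\to\mathbb{R}$ is convex and differentiable with locally Lipschitz gradient; its set of minimizers $\mathcal{X}^*$ is nonempty, $f_*=\min f$, and $x^*\in\mathcal{X}^*$ is fixed. General AdaBB algorithm. Input $x^0\in\mathbb{R}^n$, $\alpha_0>0$, $\theta_0\ge0$. Set $x^1=x^0-\alpha_0\nabla f(x^0)$. For $k=1,2,\dots$ let $$\lambda_k=\frac{\langle\nabla f(x^k)-\nabla f(x^{k-1}),x^k-x^{k-1}\rangle}{\|\nabla f(x^k)-\nabla f(x^{k-1})\|^2}.$$ (Case i) If $\lambda_k\ge\alpha_{k-1}$: $\alpha_k=\sqrt{1+\theta_{k-1}}\,\alpha_{k-1}$ and $\theta_k=\alpha_k/\alpha_{k-1}$. (Case ii) If $\alpha_{k-1}/2<\lambda_k<\alpha_{k-1}$: $\alpha_k=\min\left\{\sqrt{\frac{\lambda_k}{2(\alpha_{k-1}-\lambda_k)}},\sqrt{\frac{(1+\theta_{k-1})\lambda_k}{2\lambda_k-\alpha_{k-1}}}\right\}\alpha_{k-1}$ (Option I) or $\alpha_k=\lambda_k$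 (Option II), and $\theta_k=\frac{2\alpha_k}{\alpha_{k-1}}-\frac{\alpha_k}{\lambda_k}$. (Case iii) If $\lambda_k\le\alpha_{k-1}/2$: $\alpha_k=\sqrt{\frac{\alpha_{k-1}}{2(\alpha_{k-1}-\lambda_k)}}\,\lambda_k$ (Option I) or $\alpha_k=\lambda_k/\sqrt2$ (Option II), and $\theta_k=\alpha_k/\alpha_{k-1}$. Then $x^{k+1}=x^k-\alpha_k\nabla f(x^k)$. In each of Cases ii and iii either option may be selected. It is assumed that $\nabla f(x^k)\ne\nabla f(x^{k-1})$ for all $k\ge1$, so that $\lambda_k$ is well defined. Choice of $\theta_0$ (note $\lambda_1$ depends only on $x^0,\alpha_0$): $\theta_0=\frac{\lambda_1^2}{2\alpha_0^2}-1$ if $\lambda_1\ge\sqrt2\,\alpha_0$, and $\theta_0=0$ otherwise. Define - $M_1=0$, $P_1=\frac{\alpha_1^2}{\alpha_0}$ if $\lambda_1\ge\alpha_0$; - $M_1=\frac{\alpha_1^2}{\lambda_1\alpha_0}-\frac{\alpha_1^2}{\alpha_0^2}$, $P_1=\frac{2\alpha_1^2}{\alpha_0}-\frac{\alpha_1^2}{\lambda_1}$ if $\frac{\alpha_0}2<\lambda_1<\alpha_0$; - $M_1=\frac{\alpha_1^2}{\lambda_1^2}-\frac{\alpha_1^2}{\alpha_0\lambda_1}$, $P_1=\frac{\alpha_1^2}{\alpha_0}$ if $0<\lambda_1\le\frac{\alpha_0}2$. Local smoothness: $L>0$ is such that $f(x)-f(y)-\langle\nabla f(y),x-y\rangle\ge\frac1{2L}\|\nabla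 f(x)-\nabla f(y)\|^2$ for all $x,y\in B(x^*,R)$, where $R^2=\|x^0-x^*\|^2+\alpha_0^2(1+2M_1)\|\nabla f(x^0)\|^2+\max\{2P_1-2\alpha_0,0\}(f(x^0)-f_* )$. *)

(* Defs.v *)
From HB Require Import structures.
From mathcomp Require Import all_boot all_order all_algebra.
From mathcomp Require Import all_classical all_reals all_analysis.

Set Implicit Arguments.
Unset Strict Implicit.
Unset Printing Implicit Defensive.

Import Order.TTheory GRing.Theory Num.Theory.
Import numFieldNormedType.Exports.

Local Open Scope classical_set_scope.
Local Open Scope ring_scope.

Section Euclidean.
Context {R : realType} {n : nat}.
Implicit Types (u v x : 'rV[R]_n) (r : R).

Definition dot u v : R := \sum_(i < n) u ord0 i * v ord0 i.

(* The library norm on 'rV[R]_n is the sup norm, and its balls are open;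
   hence the following two definitions. *)
Definition enorm u : R := Num.sqrt (dot u u).

Definition cball x r : set 'rV[R]_n := [set y | enorm (y - x) <= r].

End Euclidean.

Section Functions.
Context {R : realType} {n : nat}.
Implicit Types (f : 'rV[R]_n -> R^o) (x y : 'rV[R]_n).

(* Vector of partial derivatives; it is the gradient wherever f is
   differentiable. *)
Definition grad f x : 'rV[R]_n := \row_(i < n) 'D_(delta_mx ord0 i) f x.

Definition locally_lipschitz (g : 'rV[R]_n -> 'rV[R]_n) : Prop :=
  forall x, exists r K : R, 0 < r /\
    {in cball x r &, forall y z, enorm (g y - g z) <= K * enorm (y - z)}.

Definition minimizers f : set 'rV[R]_n := [set x | forall y, f x <= f y].

(* Equal to min f as soon as f has a minimizer. *)
Definition fmin f : R := inf (range f).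

Definition smooth_on f (L : R) (A : set 'rV[R]_n) : Prop :=
  {in A &, forall x y,
    f x - f y - dot (grad f y) (x - y)
      >= (2 * L)^-1 * enorm (grad f x - grad f y) ^+ 2}.

End Functions.

Section AdaBB.
Context {R : realType} {n : nat}.

(* lambda_k = bb_step f x^k x^{k-1} *)
Definition bb_step (f : 'rV[R]_n -> R^o) (x xp : 'rV[R]_n) : R :=
  dot (grad f x - grad f xp) (x - xp) / enorm (grad f x - grad f xp) ^+ 2.

(* Admissible pairs (a, t) = (alpha_k, theta_k), given l = lambda_k,
   ap = alpha_{k-1} and tp = theta_{k-1}. The disjunctions are the choice
   between Options I and II, made afresh at every iteration. *)
Definition adabb_update (l ap tp a t : R) : Prop :=
  [/\ ap <= l ->
        a = Num.sqrt (1 + tp) * ap /\ t = a / ap,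
      ap / 2 < l < ap ->
        (a = Num.min (Num.sqrt (l / (2 * (ap - l))))
                     (Num.sqrt ((1 + tp) * l / (2 * l - ap))) * ap
         \/ a = l)
        /\ t = 2 * a / ap - a / l
    & l <= ap / 2 ->
        (a = Num.sqrt (ap / (2 * (ap - l))) * l \/ a = l / Num.sqrt 2)
        /\ t = a / ap].

Record general_adabb (f : 'rV[R]_n -> R^o)
    (x0 : 'rV[R]_n) (alpha0 theta0 : R)
    (x : nat -> 'rV[R]_n) (alpha theta : nat -> R) : Prop := GeneralAdaBB {
  adabb_alpha0_gt0 : 0 < alpha0;
  adabb_theta0_ge0 : 0 <= theta0;
  adabb_x_init : x 0%N = x0;
  adabb_alpha_init : alpha 0%N = alpha0;
  adabb_theta_init : theta 0%N = theta0;
  adabb_x_next : forall k, x k.+1 = x k - alpha k *: grad f (x k);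
  adabb_grad_neq : forall k, grad f (x k.+1) <> grad f (x k);
  adabb_stepsize : forall k,
    adabb_update (bb_step f (x k.+1) (x k)) (alpha k) (theta k)
                 (alpha k.+1) (theta k.+1)
}.

Definition theta0_choice (f : 'rV[R]_n -> R^o)
    (x0 : 'rV[R]_n) (alpha0 : R) : R :=
  let lambda1 := bb_step f (x0 - alpha0 *: grad f x0) x0 in
  if lambda1 >= Num.sqrt 2 * alpha0
  then lambda1 ^+ 2 / (2 * alpha0 ^+ 2) - 1 else 0.

(* In M1 and P1 the last branch stands for 0 < l1 <= a0 / 2: lambda_1 > 0
   whenever f is convex and the gradients at x^0 and x^1 differ. *)
Definition M1 (l1 a0 a1 : R) : R :=
  if l1 >= a0 then 0
  else if l1 > a0 / 2 then a1 ^+ 2 / (l1 * a0) - a1 ^+ 2 / a0 ^+ 2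
  else a1 ^+ 2 / l1 ^+ 2 - a1 ^+ 2 / (a0 * l1).

Definition P1 (l1 a0 a1 : R) : R :=
  if l1 >= a0 then a1 ^+ 2 / a0
  else if l1 > a0 / 2 then 2 * a1 ^+ 2 / a0 - a1 ^+ 2 / l1
  else a1 ^+ 2 / a0.

Definition adabb_radius (f : 'rV[R]_n -> R^o) (xstar : 'rV[R]_n)
    (x : nat -> 'rV[R]_n) (alpha : nat -> R) : R :=
  let l1 := bb_step f (x 1%N) (x 0%N) in
  let M := M1 l1 (alpha 0%N) (alpha 1%N) in
  let P := P1 l1 (alpha 0%N) (alpha 1%N) in
  Num.sqrt (enorm (x 0%N - xstar) ^+ 2
    + alpha 0%N ^+ 2 * (1 + 2 * M) * enorm (grad f (x 0%N)) ^+ 2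
    + Num.max (2 * P - 2 * alpha 0%N) 0 * (f (x 0%N) - fmin f)).

End AdaBB.

(* Main.v *)
Require Import Defs.
From HB Require Import structures.
From mathcomp Require Import all_boot all_order all_algebra.
From mathcomp Require Import all_classical all_reals all_analysis.
From mathcomp Require Import ring lra.

Set Implicit Arguments.
Unset Strict Implicit.
Unset Printing Implicit Defensive.

Import Order.TTheory GRing.Theory Num.Theory.
Import numFieldNormedType.Exports.

Local Open Scope classical_set_scope.
Local Open Scope ring_scope.

(** Each stepsize is compared with the curvature estimate [lambda_k] of its
    own iteration, and [lambda_k >= 1 / L] as soon as both [x^k] and
    [x^(k-1)] lie in the ball where the smoothness inequality holds: adding
    that inequality to itself with the two points exchanged gives
    cocoercivity of the gradient ([bb_step_ge]). So there are two things to
    prove: the iterates stay in the ball, and [alpha_k] is bounded below in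
    terms of [lambda_k].

    Boundedness.  Write [a], [b] for two consecutive stepsizes, [g], [h] for
    the gradients at the points [y], [z] they are applied to, and [l] for the
    value of [lambda] between them.  The definition of [l] expresses
    [|h|^2] exactly through [|g|^2] and [<h, g>]; in each of the three cases
    of the algorithm this yields
    [b^2 |h|^2 <= M a^2 |g|^2 + P a <h, g>] ([gradient_norm_bound]), where
    [M] and [P] are the quantities [M1] and [P1] computed for the current
    iteration.  Convexity turns [a <h, g>] into a bound by [f y - f z], and
    plugging this in the distance estimate of a gradient step gives a
    Lyapunov inequality ([lyapunov_step]).  It telescopes because the update
    rules are such that [P = b theta_k], [2 M <= 1] and
    [P <= a (1 + theta_(k-1))] ([adabb_update_stable]).  The initial value of
    the resulting energy is at most the square of the radius, which
    is how that radius arises ([run_init] and [adabb_run_bounded]).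
    The induction is a joint one: membership of two consecutive iterates in
    the ball gives [lambda_k > 0], and the update rules can be analysed only
    under this positivity.

    Lower bound.  When [lambda_k < alpha_(k-1)], either option gives
    [alpha_k >= lambda_k / sqrt 2]; when [lambda_k >= alpha_(k-1)] the
    stepsize does not decrease ([adabb_update_lower]).  An induction
    finishes the proof, provided it can be started: at the first iteration
    there is no bound on [alpha_0] to rely on, and the choice of [theta_0]
    ensures [alpha_1 >= lambda_1 / sqrt 2] all the same
    ([theta0_choice_bound]). *)

(** * The Euclidean inner product *)

Section DotTheory.
Context {R : realType} {n : nat}.
Implicit Types (u v w : 'rV[R]_n) (c : R).

Lemma dotC u v : dot u v = dot v u.
Proof. by apply: eq_bigr => i _; rewrite mulrC. Qed.

Lemma dotDl u v w : dot (u + v) w = dot u w + dot v w.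
Proof. by rewrite -big_split; apply: eq_bigr => i _; rewrite mxE mulrDl. Qed.

Lemma dotDr u v w : dot w (u + v) = dot w u + dot w v.
Proof. by rewrite dotC dotDl !(dotC w). Qed.

Lemma dotZl c u w : dot (c *: u) w = c * dot u w.
Proof. by rewrite mulr_sumr; apply: eq_bigr => i _; rewrite mxE mulrA. Qed.

Lemma dotZr c u w : dot w (c *: u) = c * dot w u.
Proof. by rewrite dotC dotZl dotC. Qed.

Lemma dotNl u w : dot (- u) w = - dot u w.
Proof. by rewrite -scaleN1r dotZl mulN1r. Qed.

Lemma dotNr u w : dot w (- u) = - dot w u.
Proof. by rewrite dotC dotNl dotC. Qed.

Definition dotE := (dotDl, dotDr, dotNl, dotNr, dotZl, dotZr).

Lemma dot_ge0 u : 0 <= dot u u.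
Proof. by apply: sumr_ge0 => i _; rewrite -expr2 sqr_ge0. Qed.

Lemma enorm_sqr u : enorm u ^+ 2 = dot u u.
Proof. by rewrite sqr_sqrtr // dot_ge0. Qed.

Lemma enormN u : enorm (- u) = enorm u.
Proof. by rewrite /enorm dotNl dotNr opprK. Qed.

Lemma dot_eq0 u : dot u u = 0 -> u = 0.
Proof.
move/eqP; rewrite psumr_eq0 => [/allP u0|i _]; last by rewrite -expr2 sqr_ge0.
apply/rowP => i; rewrite mxE; apply/eqP; have := u0 i.
by rewrite mem_index_enum mulf_eq0 orbb; apply.
Qed.

Lemma cball_sqrt u v c :
  dot (u - v) (u - v) <= c -> cball v (Num.sqrt c) u.
Proof. by move=> le_c; rewrite /cball /= /enorm ler_wsqrtr. Qed.

End DotTheory.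

(** * The gradient of a convex differentiable function *)

Section Gradient.
Context {R : realType} {n : nat}.
Variable f : 'rV[R]_n -> R^o.
Hypothesis f_diff : forall y, differentiable f y.

Lemma derive_grad y v : 'D_v f y = dot (grad f y) v.
Proof.
rewrite deriveE // {1}(row_sum_delta v) linear_sum /=.
by apply: eq_bigr => i _; rewrite linearZ /= mxE deriveE // mulrC.
Qed.

Hypothesis f_convex : convex_function setT f.

(** Convexity bounds the difference quotients of [f] along [z - y] by
    [f z - f y] for every positive step at most 1; the right limit of these
    quotients is the directional derivative. *)
Lemma convex_grad y z : f y + dot (grad f y) (z - y) <= f z.
Proof.
rewrite -derive_grad -lerBrDl /derive.
have dfy : derivable f y (z - y) by exact: diff_derivable.
have cvg_right := cvg_dnbhs_at_right dfy.
rewrite -(cvg_lim (@Rhausdorff R) cvg_right).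
apply: limr_le; first by apply/cvg_ex; eexists; exact: cvg_right.
near=> h.
have h_gt0 : 0 < h by near: h; exact: nbhs_right_gt.
have h_le1 : h <= 1 by near: h; exact: nbhs_right_le.
rewrite /= /GRing.scale /= ler_pdivrMl // lerBlDr.
have := f_convex (Itv01 (ltW h_gt0) h_le1) (in_setT z) (in_setT y).
have -> : conv (Itv01 (ltW h_gt0) h_le1) (z : convex_lmodType _) y
    = h *: (z - y) + y.
  rewrite [LHS](_ : _ = h *: z + (1 - h) *: y :> 'rV[R]_n) //.
  by rewrite scalerBl scale1r scalerBr addrAC addrA.
rewrite convRE /= /unstable.onem => /le_trans; apply; lra.
Unshelve. all: by end_near. Qed.

Lemma grad_monotone y z : 0 <= dot (grad f y - grad f z) (y - z).
Proof.
have := convex_grad y z; have := convex_grad z y.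
by rewrite !dotE; lra.
Qed.

End Gradient.

(** * The scalar update rules *)

Section Update.
Context {R : realType}.
Implicit Types a b l t tp : R.

Lemma sqr_sqrtM c b : 0 <= c -> (Num.sqrt c * b) ^+ 2 = c * b ^+ 2.
Proof. by move=> c_ge0; rewrite exprMn sqr_sqrtr. Qed.

Lemma sqrtM_gt0 c b : 0 < c -> 0 < b -> 0 < Num.sqrt c * b.
Proof. by move=> c_gt0 b_gt0; rewrite mulr_gt0 // sqrtr_gt0. Qed.

(** The next three lemmas replace the square roots and the options of the
    three cases by polynomial inequalities on [b ^+ 2], which are all that the
    analysis uses. *)
Lemma adabb_update_large l a tp b t : 0 < a -> 0 <= tp -> a <= l ->
  adabb_update l a tp b t ->
  [/\ 0 < b, b ^+ 2 = (1 + tp) * a ^+ 2 & t = b / a].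
Proof.
move=> a_gt0 tp_ge0 le_al [/(_ le_al) [-> ->] _ _].
have tp1_gt0 : 0 < 1 + tp by lra.
by split=> //; [exact: sqrtM_gt0 | rewrite sqr_sqrtM // ltW].
Qed.

Lemma adabb_update_mid l a tp b t :
  0 < a -> 0 < l -> 0 <= tp -> a / 2 < l < a ->
  adabb_update l a tp b t ->
  [/\ 0 < b, l ^+ 2 <= 2 * b ^+ 2, 2 * (a - l) * b ^+ 2 <= l * a ^+ 2,
      (2 * l - a) * b ^+ 2 <= (1 + tp) * l * a ^+ 2 & t = 2 * b / a - b / l].
Proof.
move=> a_gt0 l_gt0 tp_ge0 l_mid [_ /(_ l_mid) [b_opt ->] _].
have [gt_l lt_l] := andP l_mid.
have d1 : 0 < 2 * (a - l) by lra.
have d2 : 0 < 2 * l - a by lra.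
case: b_opt => [|->]; last first.
  have la2 : (2 * l - a) * l <= a ^+ 2 by nra.
  have al2 : 2 * (a - l) * l <= a ^+ 2 by nra.
  have tpl : 0 <= tp * l * a ^+ 2 by rewrite !mulr_ge0 // ltW.
  by split=> //; nra.
set c1 := l / _; set c2 := (1 + tp) * l / _.
have c1_gt0 : 0 < c1 by rewrite divr_gt0.
have c2_gt0 : 0 < c2 by rewrite divr_gt0 // mulr_gt0 //; lra.
have c1E : 2 * (a - l) * c1 = l by rewrite mulrC divfK // gt_eqF.
have c2E : (2 * l - a) * c2 = (1 + tp) * l by rewrite mulrC divfK // gt_eqF.
have a2 : 0 < a ^+ 2 by rewrite exprn_gt0.
rewrite (_ : Num.min _ _ = Num.sqrt (Num.min c1 c2)); last first.
  have [le12|/ltW le21] := leP c1 c2.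
    by rewrite min_l // ler_wsqrtr.
  by rewrite min_r // ler_wsqrtr.
move=> ->.
set c := Num.min c1 c2.
have c_gt0 : 0 < c by rewrite lt_min c1_gt0.
have cle1 : c <= c1 by rewrite ge_min lexx.
have cle2 : c <= c2 by rewrite ge_min lexx orbT.
(* [c1 >= l / (2 * a)] as [a - l <= a], and [c2 >= 1] as [2 * l - a <= l]. *)
have c_ge : l <= 2 * a * c.
  have l_c1 : l <= 2 * a * c1 by nra.
  have c2_ge1 : 1 <= c2.
    rewrite -(ler_pM2l l_gt0) mulr1.
    by have := mulr_ge0 tp_ge0 (ltW l_gt0); nra.
  have ac2 : a * 1 <= a * c2 by rewrite ler_pM2l.
  by rewrite /c; case: (leP c1 c2) => _ //; lra.
have ac : l * a <= 2 * a * c * a by rewrite ler_pM2r.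
have ll : l * l <= l * a by rewrite ler_pM2l // ltW.
split=> //.
- exact: sqrtM_gt0.
- by rewrite sqr_sqrtM ?(ltW c_gt0) //; nra.
- rewrite sqr_sqrtM ?(ltW c_gt0) // mulrA ler_pM2r //; nra.
- rewrite sqr_sqrtM ?(ltW c_gt0) // mulrA ler_pM2r //; nra.
Qed.

Lemma adabb_update_small l a tp b t :
  0 < a -> 0 < l -> l <= a / 2 ->
  adabb_update l a tp b t ->
  [/\ 0 < b, l ^+ 2 <= 2 * b ^+ 2, 2 * (a - l) * b ^+ 2 <= a * l ^+ 2
    & t = b / a].
Proof.
move=> a_gt0 l_gt0 l_small [_ _ /(_ l_small) [b_opt ->]].
have l2 : 0 < l ^+ 2 by rewrite exprn_gt0.
case: b_opt => ->.
  have d : 0 < 2 * (a - l) by lra.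
  set c := a / _.
  have c_gt0 : 0 < c by rewrite divr_gt0.
  have cE : 2 * (a - l) * c = a by rewrite mulrC divfK // gt_eqF.
  rewrite sqr_sqrtM ?(ltW c_gt0) //; split=> //.
  - exact: sqrtM_gt0.
  - by rewrite mulrA ler_peMl ?(ltW l2) //; nra.
  - by rewrite mulrA cE.
have s2 : 0 < Num.sqrt (2 : R) by rewrite sqrtr_gt0.
split=> //.
- by rewrite divr_gt0.
- by rewrite expr_div_n sqr_sqrtr //; lra.
- rewrite expr_div_n sqr_sqrtr //; nra.
Qed.

Variant M1P1_spec l a b : R -> R -> Type :=
  | M1P1Large of a <= l : M1P1_spec l a b 0 (b ^+ 2 / a)
  | M1P1Mid of a / 2 < l < a : M1P1_spec l a b
      (b ^+ 2 / (l * a) - b ^+ 2 / a ^+ 2) (2 * b ^+ 2 / a - b ^+ 2 / l)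
  | M1P1Small of l < a & l <= a / 2 : M1P1_spec l a b
      (b ^+ 2 / l ^+ 2 - b ^+ 2 / (a * l)) (b ^+ 2 / a).

Lemma M1P1P l a b : M1P1_spec l a b (M1 l a b) (P1 l a b).
Proof.
rewrite /M1 /P1; have [al|la] := leP a l; first by constructor.
by have [la2|al2] := leP l (a / 2); constructor; rewrite ?la ?al2.
Qed.

(** Nonnegativity of [l] is enough, [l = 0] being covered by the convention
    [0^-1 = 0]; this matters at the first iteration, where [M1] must be known
    to be nonnegative before [x^0] and [x^1] are known to lie in the ball. *)
Lemma M1_ge0 l a b : 0 < a -> 0 <= l -> 0 <= M1 l a b.
Proof.
move=> a_gt0; rewrite le_eqVlt => /orP[/eqP<-|l_gt0].
  have [//|/andP[]|_ _] := M1P1P; first by lra.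
  by rewrite mulr0 expr0n /= invr0 mulr0 subr0.
have b2 := sqr_ge0 b.
have [//|/andP[_ lt_la]|lt_la _] := M1P1P.
  rewrite -[X in 0 <= X](_ : b ^+ 2 * (a - l) / (l * a ^+ 2) = _); last first.
    by field; rewrite !gt_eqF.
  by rewrite divr_ge0 // mulr_ge0 ?sqr_ge0 ?subr_ge0 // ltW.
rewrite -[X in 0 <= X](_ : b ^+ 2 * (a - l) / (a * l ^+ 2) = _); last first.
  by field; rewrite !gt_eqF.
by rewrite divr_ge0 // mulr_ge0 ?sqr_ge0 ?subr_ge0 // ltW.
Qed.

(** The conditions under which the Lyapunov inequality telescopes: the energy
    left by one iteration has coefficient 1 on [a ^+ 2 * |g|^2] and
    [2 * a * (1 + tp)] on the gap, and these must dominate the coefficients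
    [2 * M1] and [2 * P1] required by the next one. *)
Lemma adabb_update_stable l a tp b t : 0 < a -> 0 < l -> 0 <= tp ->
  adabb_update l a tp b t ->
  [/\ 0 < b, 0 <= t, P1 l a b = b * t, 2 * M1 l a b <= 1
    & P1 l a b <= a * (1 + tp)].
Proof.
move=> a_gt0 l_gt0 tp_ge0 upd.
have a2 : 0 < a ^+ 2 by rewrite exprn_gt0.
have l2 : 0 < l ^+ 2 by rewrite exprn_gt0.
case: M1P1P => [le_al|l_mid|_ l_small].
- have [b_gt0 b2 ->] := adabb_update_large a_gt0 tp_ge0 le_al upd.
  have bt : b ^+ 2 / a = a * (1 + tp).
    by rewrite b2; field; rewrite gt_eqF.
  split=> //; first by rewrite divr_ge0 // ltW.
  + by field; rewrite gt_eqF.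
  + by rewrite bt.
- have [b_gt0 _ b2M b2t ->] := adabb_update_mid a_gt0 l_gt0 tp_ge0 l_mid upd.
  have [gt_l lt_l] := andP l_mid.
  have tE : 2 * b / a - b / l = b * (2 * l - a) / (a * l).
    by field; rewrite !gt_eqF.
  split=> //.
  + by rewrite tE divr_ge0 ?mulr_ge0 ?ltW //; lra.
  + by field; rewrite !gt_eqF.
  + rewrite -[X in 2 * X](_ : b ^+ 2 * (a - l) / (l * a ^+ 2) = _); last first.
      by field; rewrite !gt_eqF.
    by rewrite mulrA ler_pdivrMr ?mulr_gt0 //; lra.
  + rewrite (_ : _ - _ = (2 * l - a) * b ^+ 2 / (a * l)); last first.
      by field; rewrite !gt_eqF.
    by rewrite ler_pdivrMr ?mulr_gt0 //; apply: le_trans b2t _; lra.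
- have [b_gt0 _ b2M ->] := adabb_update_small a_gt0 l_gt0 l_small upd.
  split=> //; first by rewrite divr_ge0 // ltW.
  + by field; rewrite gt_eqF.
  + rewrite -[X in 2 * X](_ : b ^+ 2 * (a - l) / (a * l ^+ 2) = _); last first.
      by field; rewrite !gt_eqF.
    by rewrite mulrA ler_pdivrMr ?mulr_gt0 //; lra.
  + rewrite ler_pdivrMr //.
    have la2 : l ^+ 2 <= a ^+ 2 by rewrite ler_pXn2r ?nnegrE ?ltW //; lra.
    have ab2 : a * b ^+ 2 <= 2 * (a - l) * b ^+ 2.
      by rewrite ler_wpM2r ?sqr_ge0 //; lra.
    have b2 : b ^+ 2 <= a ^+ 2.
      rewrite -(ler_pM2l a_gt0) (le_trans ab2) // (le_trans b2M) //.
      by rewrite ler_wpM2l // ltW.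
    apply: le_trans b2 _.
    by have := mulr_ge0 tp_ge0 (ltW a2); lra.
Qed.

(** Here [G], [H], [I] stand for [<g, g>], [<h, h>] and [<h, g>].  The second
    hypothesis is the definition of [l], and determines [H] from [G] and [I].
    If [a / 2 < l < a] the bound is this equation.  If [a <= l], the secant
    equation makes [G - I] a nonnegative multiple of [|h - g|^2], and
    the slack is a nonnegative multiple of it.  If [l <= a / 2], the coefficient
    of [I] in the equation is not positive, so convexity cannot bound that
    term; the slack is then a multiple of [(a / l - 1) * G + I], itself a
    positive multiple of [|(1 - a / l) g - h|^2]. *)
Lemma gradient_norm_bound (G H I : R) l a b : 0 < a -> 0 < l ->
  (forall c, 0 <= c ^+ 2 * G - 2 * c * I + H) ->
  l * (H - 2 * I + G) = a * (G - I) ->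
  b ^+ 2 * H <= M1 l a b * (a ^+ 2 * G) + P1 l a b * (a * I).
Proof.
move=> a_gt0 l_gt0 psd secant.
have b2 := sqr_ge0 b.
have HE : H = (a / l - 1) * G + (2 - a / l) * I.
  have -> : H = a * (G - I) / l - G + 2 * I.
    by rewrite -secant mulrC mulKf ?gt_eqF //; ring.
  by field; rewrite gt_eqF.
case: M1P1P => [le_al|_|lt_la l_small].
- have GI : 0 <= G - I.
    rewrite -(pmulr_rge0 _ a_gt0) -secant mulr_ge0 ?(ltW l_gt0) //.
    by have := psd 1; rewrite expr1n; lra.
  rewrite mul0r add0r mulrA divfK ?gt_eqF // ler_wpM2l //.
  rewrite -subr_ge0 HE.
  rewrite (_ : _ - _ = (1 - a / l) * (G - I)); last by ring.
  by rewrite mulr_ge0 // subr_ge0 ler_pdivrMr // mul1r.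
- rewrite HE le_eqVlt; apply/orP; left; apply/eqP; field.
  by rewrite !gt_eqF.
- rewrite -subr_ge0; have := psd (1 - a / l).
  rewrite (_ : _ - 2 * _ * I + H = (a / l) * ((a / l - 1) * G + I)); last first.
    by rewrite HE; ring.
  have al : 0 < a / l by rewrite divr_gt0.
  rewrite pmulr_rge0 // => GI.
  rewrite (_ : _ - _ = b ^+ 2 * (a / l - 1) * ((a / l - 1) * G + I)); last first.
    by rewrite HE; field; rewrite !gt_eqF.
  have r_ge1 : 0 <= a / l - 1 by rewrite subr_ge0 ler_pdivlMr //; lra.
  by rewrite mulr_ge0 // mulr_ge0.
Qed.

(** The last hypothesis is on the squared stepsize of the increasing case, so
    that it can be supplied by the previous lower bound on [a] at a general
    iteration, and by the choice of [theta_0] at the first one. *)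
Lemma adabb_update_lower l a tp b t m : 0 < a -> 0 < l -> 0 <= tp -> 0 < m ->
  adabb_update l a tp b t -> m ^+ 2 <= l ^+ 2 / 2 ->
  (a <= l -> m ^+ 2 <= (1 + tp) * a ^+ 2) -> m <= b.
Proof.
move=> a_gt0 l_gt0 tp_ge0 m_gt0 upd ml ma.
suff [b_gt0 mb] : 0 < b /\ m ^+ 2 <= b ^+ 2.
  by move: mb; rewrite ler_pXn2r // nnegrE ltW.
have [le_al|lt_la] := leP a l.
  by have [? -> _] := adabb_update_large a_gt0 tp_ge0 le_al upd; split; auto.
have [l_small|l_big] := leP l (a / 2).
  have [? ? _ _] := adabb_update_small a_gt0 l_gt0 l_small upd.
  by split=> //; lra.
have l_mid : a / 2 < l < a by rewrite l_big.
have [? ? _ _ _] := adabb_update_mid a_gt0 l_gt0 tp_ge0 l_mid upd.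
by split=> //; lra.
Qed.

(** The choice of [theta0] is calibrated for this bound: with
    [l = lambda_1] and [a = alpha_0], the right-hand side is
    [alpha_1 ^+ 2] when [a <= l], and the bound is an equality in the first
    branch. *)
Lemma theta0_choice_bound l a : 0 < a -> 0 < l ->
  l ^+ 2 / 2 <= (1 + if Num.sqrt 2 * a <= l
                     then l ^+ 2 / (2 * a ^+ 2) - 1 else 0) * a ^+ 2.
Proof.
move=> a_gt0 l_gt0.
have sa_gt0 : 0 < Num.sqrt 2 * a by rewrite mulr_gt0 // sqrtr_gt0.
have [_|lt_l] := leP (Num.sqrt 2 * a) l.
  by rewrite le_eqVlt; apply/orP; left; apply/eqP; field; rewrite gt_eqF.
have : l ^+ 2 <= (Num.sqrt 2 * a) ^+ 2.
  by rewrite ler_pXn2r ?nnegrE // ltW.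
by rewrite exprMn sqr_sqrtr //; lra.
Qed.

End Update.

(** * One gradient step *)

Section Iteration.
Context {R : realType} {n : nat}.
Variable f : 'rV[R]_n -> R^o.
Implicit Types (y z xs : 'rV[R]_n) (a b l L : R).

Lemma fmin_eq xs : minimizers f xs -> fmin f = f xs.
Proof.
move=> xs_min; apply/eqP; rewrite eq_le /fmin; apply/andP; split.
  by apply: ge_inf; [exists (f xs) => _ [y _ <-] | exists xs].
by apply: lb_le_inf; [exists (f xs); exists xs | move=> _ [y _ <-]].
Qed.

Lemma grad_gap_gt0 y z : grad f y <> grad f z ->
  0 < dot (grad f y - grad f z) (grad f y - grad f z).
Proof.
move=> neq; rewrite lt_neqAle dot_ge0 andbT eq_sym; apply/eqP => /dot_eq0 /eqP.
by rewrite subr_eq0 => /eqP.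
Qed.

(** Since [z - y] is a multiple of the gradient at [y], the Barzilai-Borwein
    quotient involves inner products of the two gradients only. *)
Lemma bb_step_gradient_step y z a :
  z = y - a *: grad f y -> grad f z <> grad f y ->
  bb_step f z y * (dot (grad f z) (grad f z) - 2 * dot (grad f z) (grad f y)
                   + dot (grad f y) (grad f y))
  = a * (dot (grad f y) (grad f y) - dot (grad f z) (grad f y)).
Proof.
move=> zE /grad_gap_gt0 gap; rewrite /bb_step enorm_sqr.
have -> : z - y = - (a *: grad f y) by rewrite zE addrAC subrr add0r.
move: (grad f z) (grad f y) gap => h g gap.
have -> : dot h h - 2 * dot h g + dot g g = dot (h - g) (h - g).
  by rewrite !dotE (dotC g h); move: (dot h h) (dot h g) (dot g g) => *; ring.
by rewrite divfK ?gt_eqF // !dotE; move: (dot h g) (dot g g) => *; ring.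
Qed.

(** Adding the smoothness inequality for [(y, z)] and for [(z, y)] cancels the
    values of [f] and leaves cocoercivity. *)
Lemma bb_step_ge y z L A : 0 < L -> smooth_on f L A -> A y -> A z ->
  grad f y <> grad f z -> L^-1 <= bb_step f y z.
Proof.
move=> L_gt0 sm Ay Az neq.
have gap := grad_gap_gt0 neq.
have at_z := sm y z (mem_set Ay) (mem_set Az).
have := sm z y (mem_set Az) (mem_set Ay).
rewrite -(opprB y) dotNr -(opprB (grad f y)) enormN => at_y.
have split_dot : dot (grad f y - grad f z) (y - z)
    = dot (grad f y) (y - z) - dot (grad f z) (y - z) by rewrite dotDl dotNl.
rewrite -enorm_sqr in gap.
rewrite /bb_step split_dot; move: at_z at_y gap; rewrite invfM.
move: (enorm _ ^+ 2) (dot _ _) (dot _ _) (f y) (f z) => g2 p q fy fz *.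
by rewrite ler_pdivlMr //; lra.
Qed.

Hypothesis f_diff : forall y, differentiable f y.
Hypothesis f_convex : convex_function setT f.

Lemma bb_step_ge0 y z : 0 <= bb_step f y z.
Proof. by rewrite divr_ge0 ?grad_monotone ?sqr_ge0. Qed.

Lemma gradient_step_dist z z' xs b : 0 <= b -> z' = z - b *: grad f z ->
  dot (z' - xs) (z' - xs) + 2 * b * (f z - f xs)
    <= dot (z - xs) (z - xs) + b ^+ 2 * dot (grad f z) (grad f z).
Proof.
move=> b_ge0 ->; have := ler_wpM2l b_ge0 (convex_grad f_diff f_convex z xs).
move: (grad f z) (f z) (f xs) => h fz fxs.
rewrite -(opprB z) addrAC; move: (z - xs) => w.
rewrite !dotE (dotC w h); move: (dot h h) (dot h w) (dot w w) => hh hw ww; lra.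
Qed.

(** The distance estimate for the step from [z] leaves an error
    [b ^+ 2 * |h|^2].  Bounding twice this quantity by [gradient_norm_bound]
    leaves one copy on the left-hand side, which feeds the next step, and the
    factor 2 on the right. *)
Lemma lyapunov_step y z z' xs a b (l := bb_step f z y) :
  z = y - a *: grad f y -> z' = z - b *: grad f z ->
  0 < a -> 0 < b -> 0 < l -> 0 <= P1 l a b -> grad f z <> grad f y ->
  dot (z' - xs) (z' - xs) + b ^+ 2 * dot (grad f z) (grad f z)
    + 2 * (b + P1 l a b) * (f z - f xs)
  <= dot (z - xs) (z - xs) + 2 * M1 l a b * (a ^+ 2 * dot (grad f y) (grad f y))
    + 2 * P1 l a b * (f y - f xs).
Proof.
move=> zE z'E a_gt0 b_gt0 l_gt0 P_ge0 neq.
have dist := gradient_step_dist xs (ltW b_gt0) z'E.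
have psd c : 0 <= c ^+ 2 * dot (grad f y) (grad f y)
    - 2 * c * dot (grad f z) (grad f y) + dot (grad f z) (grad f z).
  have := dot_ge0 (c *: grad f y - grad f z).
  move: (grad f y) (grad f z) => g h; rewrite !dotE (dotC g h).
  by move: (dot g g) (dot h g) (dot h h) => gg hg hh; lra.
have norm := gradient_norm_bound b a_gt0 l_gt0 psd
  (bb_step_gradient_step zE neq).
have descent := ler_wpM2l P_ge0 (convex_grad f_diff f_convex z y).
have yz : y - z = a *: grad f y by rewrite zE opprB addrC subrK.
rewrite yz dotZr in descent.
move: (M1 l a b) (P1 l a b) (f y) (f z) (f xs) (dot (grad f y) (grad f y))
  (dot (grad f z) (grad f y)) (dot (grad f z) (grad f z))
  (dot (z - xs) (z - xs)) (dot (z' - xs) (z' - xs)) descent norm dist.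
by move=> *; lra.
Qed.

End Iteration.

(** * Boundedness of the iterates *)

Section AdaBBRun.
Context {R : realType} {n : nat}.
Variables (f : 'rV[R]_n -> R^o) (xstar x0 : 'rV[R]_n) (alpha0 theta0 : R).
Variables (x : nat -> 'rV[R]_n) (alpha theta : nat -> R) (L : R).
Hypothesis f_convex : convex_function setT f.
Hypothesis f_diff : forall y, differentiable f y.
Hypothesis xstar_min : minimizers f xstar.
Hypothesis adabb : general_adabb f x0 alpha0 theta0 x alpha theta.
Hypothesis L_gt0 : 0 < L.
Hypothesis f_smooth :
  smooth_on f L (cball xstar (adabb_radius f xstar x alpha)).

Local Notation lambda k := (bb_step f (x k.+1) (x k)).
Local Notation M k := (M1 (lambda k) (alpha k) (alpha k.+1)).
Local Notation P k := (P1 (lambda k) (alpha k) (alpha k.+1)).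
Local Notation dist2 k := (dot (x k - xstar) (x k - xstar)).
Local Notation grad2 k := (dot (grad f (x k)) (grad f (x k))).
Local Notation gap k := (f (x k) - f xstar).

Let C : R := dist2 0%N + alpha 0%N ^+ 2 * (1 + 2 * M 0%N) * grad2 0%N
  + Num.max (2 * P 0%N - 2 * alpha 0%N) 0 * gap 0%N.

(** The right-hand side of [lyapunov_step] for the step from [x k.+1]; it
    bounds the squared distance of [x k.+2] to the minimizer. *)
Definition energy k : R :=
  dist2 k.+1 + 2 * M k * (alpha k ^+ 2 * grad2 k) + 2 * P k * gap k.

Let gap_ge0 k : 0 <= gap k.
Proof. by rewrite subr_ge0 xstar_min. Qed.

Let alpha_grad2_ge0 k : 0 <= alpha k ^+ 2 * grad2 k.
Proof. by rewrite mulr_ge0 ?sqr_ge0 ?dot_ge0. Qed.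

Let radiusE : adabb_radius f xstar x alpha = Num.sqrt C.
Proof. by rewrite /adabb_radius !enorm_sqr (fmin_eq xstar_min). Qed.

(** The step from [x^0] is not covered by the Lyapunov inequality; the plain
    distance estimate replaces it, with error [alpha_0^2 |g_0|^2] and gain
    [2 * alpha_0 * (f x^0 - min f)]. *)
Let run_init : [/\ dist2 0%N <= C, dist2 1%N <= C & energy 0 <= C].
Proof.
have [a_gt0 a0E] := (adabb_alpha0_gt0 adabb, adabb_alpha_init adabb).
rewrite -a0E in a_gt0.
have M_ge0 : 0 <= M 0%N by rewrite M1_ge0 // bb_step_ge0.
have := gradient_step_dist f_diff f_convex xstar (ltW a_gt0)
  (adabb_x_next adabb 0).
have agap : 0 <= alpha 0%N * gap 0%N by rewrite mulr_ge0 // ltW.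
have Mg : 0 <= M 0%N * (alpha 0%N ^+ 2 * grad2 0%N) by rewrite mulr_ge0.
have G := alpha_grad2_ge0 0.
have max0 : 0 <= Num.max (2 * P 0%N - 2 * alpha 0%N) 0 * gap 0%N.
  by rewrite mulr_ge0 // le_max lexx orbT.
have maxP : (2 * P 0%N - 2 * alpha 0%N) * gap 0%N <=
    Num.max (2 * P 0%N - 2 * alpha 0%N) 0 * gap 0%N.
  by rewrite ler_wpM2r // le_max lexx.
by rewrite /energy /C; split; lra.
Qed.

Let lambda_ge k : dist2 k <= C -> dist2 k.+1 <= C -> L^-1 <= lambda k.
Proof.
move=> dk dk1.
apply: (bb_step_ge L_gt0 f_smooth); last by move=> /(adabb_grad_neq adabb).
  by rewrite radiusE; exact: cball_sqrt.
by rewrite radiusE; exact: cball_sqrt.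
Qed.

(** The energy bound at [k] places [x k.+2] in the ball; only then is
    [lambda] at [k.+1] known to be positive, and the stability conditions at
    [k.+1] convert the left-hand side of [lyapunov_step] into the next
    energy. *)
Lemma adabb_run_bounded k :
  [/\ 0 < alpha k, 0 <= theta k, L^-1 <= lambda k, dist2 k.+1 <= C
    & energy k <= C].
Proof.
have Linv_gt0 : 0 < L^-1 by rewrite invr_gt0.
elim: k => [|k [a_gt0 t_ge0 l_ge d_le e_le]].
  have [d0 d1 e0] := run_init.
  split=> //; last exact: lambda_ge.
    by rewrite (adabb_alpha_init adabb); exact: adabb_alpha0_gt0 adabb.
  by rewrite (adabb_theta_init adabb); exact: adabb_theta0_ge0 adabb.
have l_gt0 := lt_le_trans Linv_gt0 l_ge.
have [b_gt0 t1_ge0 PE _ _] :=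
  adabb_update_stable a_gt0 l_gt0 t_ge0 (adabb_stepsize adabb k).
have P_ge0 : 0 <= P k by rewrite PE mulr_ge0 // ltW.
have PD : alpha k.+1 * (1 + theta k.+1) = alpha k.+1 + P k.
  by rewrite PE mulrDr mulr1.
have neq : grad f (x k.+1) <> grad f (x k) by move=> /(adabb_grad_neq adabb).
have := lyapunov_step f_diff f_convex xstar
  (adabb_x_next adabb k) (adabb_x_next adabb k.+1) a_gt0 b_gt0 l_gt0 P_ge0 neq.
move=> /le_trans /(_ e_le) lyap.
have bgap : 0 <= (alpha k.+1 + P k) * gap k.+1.
  by rewrite mulr_ge0 // addr_ge0 // ltW.
have G := alpha_grad2_ge0 k.+1.
have d2_le : dist2 k.+2 <= C by lra.
have l1_ge := lambda_ge d_le d2_le.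
have l1_gt0 := lt_le_trans Linv_gt0 l1_ge.
have [_ _ _ M_le P1_le] :=
  adabb_update_stable b_gt0 l1_gt0 t1_ge0 (adabb_stepsize adabb k.+1).
rewrite PD in P1_le.
split=> //; apply: le_trans lyap; rewrite /energy.
apply: lerD; last by rewrite -!mulrA ler_pM2l // ler_wpM2r.
by rewrite lerD2l -[leRHS]mul1r ler_wpM2r.
Qed.

End AdaBBRun.

(** * The lower bound on the stepsizes *)

Theorem lemma4p1 (R : realType) (n : nat) (f : 'rV[R]_n -> R^o)
    (f_convex : convex_function setT f)
    (f_diff : forall y, differentiable f y)
    (f_lip : locally_lipschitz (grad f))
    (xstar : 'rV[R]_n) (xstar_min : minimizers f xstar)
    (x0 : 'rV[R]_n) (alpha0 : R)
    (x : nat -> 'rV[R]_n) (alpha theta : nat -> R)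
    (adabb : general_adabb f x0 alpha0 (theta0_choice f x0 alpha0)
                           x alpha theta)
    (L : R) (L_gt0 : 0 < L)
    (f_smooth : smooth_on f L (cball xstar (adabb_radius f xstar x alpha))) :
  (forall i, (1 <= i)%N -> alpha i >= 1 / (Num.sqrt 2 * L)) /\
  (forall k, (1 <= k)%N ->
     \sum_(1 <= i < k.+1) alpha i >= k%:R / (Num.sqrt 2 * L)).
Proof.
have Linv_gt0 : 0 < L^-1 by rewrite invr_gt0.
have bounded := adabb_run_bounded f_convex f_diff xstar_min adabb L_gt0 f_smooth.
set m : R := 1 / (Num.sqrt 2 * L).
have m_gt0 : 0 < m by rewrite divr_gt0 // mulr_gt0 // sqrtr_gt0.
have m2E : m ^+ 2 = L^-1 ^+ 2 / 2.
  by rewrite expr_div_n expr1n exprMn sqr_sqrtr //; field; rewrite gt_eqF.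
have m2_le l : L^-1 <= l -> m ^+ 2 <= l ^+ 2 / 2.
  move=> Ll; rewrite m2E ler_pM2r // ler_pXn2r // nnegrE ltW //.
  exact: lt_le_trans Ll.
have alpha_ge i : m <= alpha i.+1.
  elim: i => [|i IHi].
    have [a_gt0 t_ge0 l_ge _ _] := bounded 0%N.
    have l_gt0 := lt_le_trans Linv_gt0 l_ge.
    apply: (adabb_update_lower a_gt0 l_gt0 t_ge0 m_gt0 (adabb_stepsize adabb 0)).
      exact: m2_le.
    move=> le_al; apply: le_trans (m2_le _ l_ge) _.
    rewrite (adabb_theta_init adabb) /theta0_choice.
    rewrite -(adabb_x_init adabb) -(adabb_alpha_init adabb).
    rewrite -(adabb_x_next adabb) /=.
    exact: theta0_choice_bound.
  have [a_gt0 t_ge0 l_ge _ _] := bounded i.+1.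
  have l_gt0 := lt_le_trans Linv_gt0 l_ge.
  apply: (adabb_update_lower a_gt0 l_gt0 t_ge0 m_gt0
    (adabb_stepsize adabb i.+1)).
    exact: m2_le.
  move=> _.
  have ma : m ^+ 2 <= alpha i.+1 ^+ 2 by rewrite ler_pXn2r // nnegrE ltW.
  apply: (le_trans ma); rewrite ler_peMl ?sqr_ge0 //; lra.
split=> [[//|i] _|k _]; first exact: alpha_ge.
rewrite -[leLHS](_ : \sum_(1 <= i < k.+1) m = _); last first.
  by rewrite sumr_const_nat subn1 /m div1r mulr_natl.
by apply: ler_sum_nat => -[//|i] _; exact: alpha_ge.
Qed.
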